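(* Let $p$ be a prime, $k$ a positive integer, $\phi$ an automorphism of the field $\mathbb{F}_{p^k}$, and let $R$ be the Corbas $(p,k,\phi)$-ring. Then $\mu_0(R) = 2$, $\mu_1(R) = p(p^k - 1)$, and there are exactly $p^{k+1} - p + 1$ distinct power maps over $R$. If $\phi$ is the identity automorphism, then exactly $p^k - 1$ of these power maps are periodic.
   Context: The Corbas $(p,k,\phi)$-ring is the ring $R$ with additive group $R^+ = \mathbb{F}_{p^k} \oplus \mathbb{F}_{p^k}$ and multiplication $(a,b)\cdot(c,d) = (ac,\ ad + b\phi(c))$. A power map over a ring $R$ is a function $R \to R$ of the form $f(x) = x^n$ for a fixed positive integer $n$; distinct means distinct as functions. A power map $f$ is periodic if there is a nonzero $h \in R$ with $f(x+h) = f(x)$ for all $x \in R$. The exponential period $\mu_1(R)$ is the smallest positive integer $n$ such that for each $x \in R$ there is a positive integer $m(x)$ with $x^{m(x)+n} = x^{m(x)}$. The onset of exponential periodicity is $\mu_0(R) = \max_{x \in R} \min\{m \in \mathbb{N} : x^{m+\mu_1} = x^m\}$, where $\mathbb{N}$ is the set of positive integers. *)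

(* Defs.v *)
From HB Require Import structures.
From mathcomp Require Import all_boot all_order all_algebra all_field.
From mathcomp Require Import boolp classical_sets functions cardinality.

Set Implicit Arguments.
Unset Strict Implicit.
Unset Printing Implicit Defensive.

Import GRing.Theory.

Local Open Scope classical_set_scope.
Local Open Scope ring_scope.

(* Alias of F * F: the instances below give it the Corbas multiplication,
   not the componentwise one that F * F itself carries. *)
Definition corbas (F : finFieldType) (phi : {rmorphism F -> F}) : Type :=
  (F * F)%type.

Section Corbas.
Variables (F : finFieldType) (phi : {rmorphism F -> F}).

HB.instance Definition _ := Finite.on (corbas phi).
HB.instance Definition _ := GRing.Zmodule.on (corbas phi).

Definition corbas_one : corbas phi := (1, 0).

Definition corbas_mul (x y : corbas phi) : corbas phi :=
  (x.1 * y.1, x.1 * y.2 + x.2 * phi y.1).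

Fact corbas_mulA : associative corbas_mul.
Proof.
move=> [a b] [c d] [e f]; rewrite /corbas_mul /=.
by rewrite mulrA rmorphM mulrDr mulrDl !mulrA addrA.
Qed.

Fact corbas_mul1l : left_id corbas_one corbas_mul.
Proof. by move=> [c d]; rewrite /corbas_mul /= !mul1r mul0r addr0. Qed.

Fact corbas_mul1r : right_id corbas_one corbas_mul.
Proof.
by move=> [a b]; rewrite /corbas_mul /= rmorph1 mulr0 !mulr1 add0r.
Qed.

Fact corbas_mulDl : left_distributive corbas_mul +%R.
Proof.
move=> [a b] [c d] [e f]; rewrite /corbas_mul /=.
by congr pair; rewrite !mulrDl // addrACA.
Qed.

Fact corbas_mulDr : right_distributive corbas_mul +%R.
Proof.
move=> [a b] [c d] [e f]; rewrite /corbas_mul /=.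
by congr pair; rewrite ?rmorphD !mulrDr // addrACA.
Qed.

Fact corbas_one_neq0 : corbas_one != 0.
Proof. by apply/eqP=> -[] /eqP; rewrite oner_eq0. Qed.

HB.instance Definition _ := GRing.Zmodule_isNzRing.Build (corbas phi)
  corbas_mulA corbas_mul1l corbas_mul1r corbas_mulDl corbas_mulDr
  corbas_one_neq0.

End Corbas.

Definition power_map (R : nzRingType) (f : R -> R) : Prop :=
  exists2 n : nat, (0 < n)%N & forall x, f x = x ^+ n.

Definition periodic_map (R : nzRingType) (f : R -> R) : Prop :=
  exists2 h : R, h != 0 & forall x, f (x + h) = f x.

(* mu0 and mu1 are defined for finite rings, where the minima and the maximum
   in their definitions exist. *)
Section ExponentialPeriod.
Variable R : finNzRingType.

Definition exp_period_pred (n : nat) : bool :=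
  (0 < n)%N &&
  `[< forall x : R, exists2 m : nat, (0 < m)%N & x ^+ (m + n) = x ^+ m >].

Fact exp_period_ex : exists n : nat, exp_period_pred n.
Proof.
pose g (i : 'I_(#|{ffun R -> R}|.+1)) := [ffun x : R => x ^+ i.+1].
have /injectivePn[i [j ij gij]] : ~~ injectiveb g.
  apply/negP => /injectiveP /leq_card.
  by rewrite card_ord ltnn.
wlog lij : i j ij gij / (i < j)%N.
  move=> H; have [/H|/H|/val_inj/eqP] := ltngtP i j; first exact.
    by apply=> //; rewrite eq_sym.
  by rewrite (negbTE ij).
exists (j - i)%N; rewrite /exp_period_pred subn_gt0 lij /=.
apply/asboolP => x; exists i.+1 => //.
rewrite addSn subnKC ?(ltnW lij) //.
by move/ffunP/(_ x): gij; rewrite !ffunE.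
Qed.

Definition mu1 : nat := ex_minn exp_period_ex.

Fact exp_onset_ex (x : R) :
  exists m : nat, (0 < m)%N && (x ^+ (m + mu1) == x ^+ m).
Proof.
rewrite /mu1; case: ex_minnP => n /andP[_ /asboolP/(_ x)[m m0 e]] _.
by exists m; rewrite m0 e eqxx.
Qed.

Definition mu0 : nat := (\max_(x : R) ex_minn (exp_onset_ex x))%N.

End ExponentialPeriod.

Arguments mu1 : clear implicits.
Arguments mu0 : clear implicits.

(* Main.v *)
Require Import Defs.
From mathcomp Require Import all_boot all_order all_algebra all_field.
From mathcomp Require Import cyclic.
From mathcomp Require Import boolp classical_sets functions cardinality.
Import GRing.Theory.

Local Open Scope classical_set_scope.
Local Open Scope card_scope.
Local Open Scope ring_scope.

(** Write N = p (q - 1) with q = #|F|.  The closed form of powers,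
    (a, b) ^ n = (a ^ n, b s_n(a)) with
    s_n(a) = a ^ (n-1) + a ^ (n-2) phi(a) + ... + phi(a) ^ (n-1)
    ([corbas_expr]), controls everything.

    If a <> 0, then (a, b) ^ N = 1 ([corbas_unit_expr]): either phi(a) = a and
    s_N(a) = N a ^ (N-1) vanishes in characteristic p, or s_N(a) is the quotient
    of a ^ N - phi(a) ^ N = 1 - 1 by a - phi(a).  If a = 0, the square of (a, b)
    is zero.  Conversely the two units (1, 1), of order p, and (g, 0), where g
    generates the multiplicative group of F, force N to divide every exponential
    period ([corbas_period_dvd]), and (0, 1) is not equal to any of its higher
    powers.  Hence x ^ i and x ^ j are the same map exactly when i = j or
    i, j >= 2 are congruent modulo N ([corbas_expr_eqP]), which gives the
    onset, the period, and the N + 1 power maps x, ..., x ^ (N+1).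

    When phi is the identity, (a, b) ^ n = (a ^ n, n a ^ (n-1) b).  If p | n, the
    second coordinate vanishes and (0, 1) is a period.  Otherwise a period h has
    h ^ n = 0 ^ n = 0, so h = (0, d), and evaluation at (1, 0) gives n d = 0, so
    h = 0.  The periodic maps are thus the x ^ (p m), and these depend only on m
    modulo q - 1. *)

Lemma finField_expf_pred_card (F : finFieldType) (c : F) :
  c != 0 -> c ^+ #|F|.-1 = 1.
Proof.
move=> c0; apply: (mulfI c0); rewrite mulr1 -exprS prednK ?expf_card //.
exact: leq_trans (finNzRing_gt1 F).
Qed.

(** The q - 1 nonzero elements are all (q-1)-th roots of unity, and as many
    distinct n-th roots of unity as n include a primitive one. *)
Lemma finField_prim_root (F : finFieldType) :
  exists g : F, (#|F|.-1).-primitive_root g.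
Proof.
have q1 : (0 < #|F|.-1)%N by rewrite -subn1 subn_gt0 finNzRing_gt1.
have : has (#|F|.-1).-primitive_root (enum (predC1 (0 : F))).
  apply: has_prim_root => //; last by rewrite -cardE cardC1.
    apply/allP => x; rewrite mem_enum inE => x0; apply/unity_rootP.
    exact: finField_expf_pred_card.
  exact: enum_uniq.
by case/hasP => g _ gP; exists g.
Qed.

Section Powers.
Variables (F : finFieldType) (phi : {rmorphism F -> F}).

Lemma corbas_expr (a b : F) (n : nat) :
  ((a, b) : corbas phi) ^+ n =
  (a ^+ n, b * \sum_(i < n) a ^+ (n.-1 - i) * phi a ^+ i).
Proof.
elim: n => [|n IHn]; first by rewrite big_ord0 mulr0 !expr0.
rewrite exprS IHn.
transitivity (corbas_mul ((a, b) : corbas phi)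
  (a ^+ n, b * \sum_(i < n) a ^+ (n.-1 - i) * phi a ^+ i)) => //.
rewrite /corbas_mul /= -exprS rmorphXn /=; congr pair.
rewrite big_ord_recr /= subnn mul1r mulrDr mulrCA; congr (b * _ + _).
rewrite mulr_sumr; apply: eq_bigr => i _; rewrite mulrA -exprS.
by congr (a ^+ _ * _); case: n i {IHn} => [[]|n] i //=; rewrite subSn // -ltnS.
Qed.

Lemma corbas_expr_fixed (a b : F) (n : nat) :
  phi a = a -> ((a, b) : corbas phi) ^+ n = (a ^+ n, b * (a ^+ n.-1 *+ n)).
Proof.
move=> fa; rewrite corbas_expr fa; congr (_, b * _).
rewrite (eq_bigr (fun=> a ^+ n.-1)) ?sumr_const ?card_ord // => i _.
by rewrite -exprD subnK //; case: n i => [[]|n] i //=; rewrite -ltnS.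
Qed.

Lemma corbas_expr_nonunit (b : F) (n : nat) :
  (1 < n)%N -> ((0, b) : corbas phi) ^+ n = 0.
Proof.
case: n => [|[|n]] // _.
by rewrite corbas_expr_fixed ?rmorph0 //= !expr0n mul0rn mulr0.
Qed.

End Powers.

Section Period.
Variables (p : nat) (F : finFieldType) (phi : {rmorphism F -> F}).
Hypothesis charFp : p \in [pchar F].

Let N := (p * #|F|.-1)%N.

(** The cases phi(a) = a and phi(a) <> a differ: in the first s_N(a) vanishes
    because p | N, in the second because (a - phi(a)) s_N(a) = a ^ N - phi(a) ^ N
    = 0. *)
Lemma corbas_unit_expr (x : corbas phi) : x.1 != 0 -> x ^+ N = 1.
Proof.
case: x => a b /= a0.
have unitX (c : F) : c != 0 -> c ^+ N = 1.
  by move=> c0; rewrite /N mulnC exprM finField_expf_pred_card ?expr1n.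
have [fa|nfa] := eqVneq (phi a) a.
  rewrite corbas_expr_fixed // unitX // -mulr_natr.
  have /eqP-> : (N%:R == 0 :> F) by rewrite -(dvdn_pcharf charFp) dvdn_mulr.
  by rewrite !mulr0.
rewrite corbas_expr unitX //.
have : a ^+ N - phi a ^+ N = 0 by rewrite !unitX ?fmorph_eq0 // subrr.
rewrite subrXX => /eqP; rewrite mulf_eq0 subr_eq0 eq_sym (negPf nfa) /=.
by move=> /eqP ->; rewrite mulr0.
Qed.

Lemma corbas_period (x : corbas phi) (m : nat) :
  (1 < m)%N -> x ^+ (m + N) = x ^+ m.
Proof.
move=> m1; have [x0|x0] := eqVneq x.1 0.
  by case: x x0 => a b /= ->; rewrite !corbas_expr_nonunit ?ltn_addr.
by rewrite exprD corbas_unit_expr // mulr1.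
Qed.

Lemma corbas_expr_mod (x : corbas phi) (i j : nat) :
  (1 < i)%N -> (1 < j)%N -> i = j %[mod N] -> x ^+ i = x ^+ j.
Proof.
wlog le_ij : i j / (i <= j)%N => [W i1 j1 e|i1 j1 /esym/eqP].
  by case/orP: (leq_total i j) => l; [|symmetry]; apply: W.
rewrite eqn_mod_dvd // => /dvdnP[c e].
have -> : j = (i + c * N)%N by rewrite -e subnKC.
elim: c {e} => [|c IHc]; first by rewrite addn0.
by rewrite mulSn addnCA addnC corbas_period // ltn_addr.
Qed.

(** The powers (1, m) of (1, 1) detect divisibility by p and those of (g, 0),
    with g a generator of the multiplicative group, divisibility by q - 1; these
    two numbers are coprime. *)
Lemma corbas_period_dvd (n : nat) :
  (forall x : corbas phi, exists m, x ^+ (m + n) = x ^+ m) -> (N %| n)%N.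
Proof.
move=> per; have [g gP] := finField_prim_root F.
have pF : (p %| n)%N.
  have [m] := per (1, 1).
  rewrite !corbas_expr_fixed ?rmorph1 // !expr1n !mul1r => -[/eqP].
  by rewrite mulrnDr -subr_eq0 addrAC subrr add0r -(dvdn_pcharf charFp).
have qF : (#|F|.-1 %| n)%N.
  have [m] := per (g, 0); rewrite !corbas_expr => -[e _].
  rewrite (prim_order_dvd gP); apply/eqP.
  have g0 : g ^+ m != 0.
    rewrite expf_neq0 //; apply/negP => /eqP g0.
    have := prim_expr_order gP; rewrite g0 expr0n.
    rewrite gtn_eqF ?(prim_order_gt0 gP) // => /esym/eqP.
    by rewrite oner_eq0.
  by apply: (mulfI g0); rewrite -exprD e mulr1.
rewrite Gauss_dvd ?pF //.
(* The order of a primitive root of unity in F is prime to the characteristic. *)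
rewrite prime_coprime ?(pcharf_prime charFp) //; apply/negP => pq1.
have := prim_root_dvd_eq0 gP (dvdnn _).
by rewrite -(dvdn_pcharf charFp) pq1.
Qed.

(** The exponent 1 stands apart, since x and x ^ j with j > 1 differ at (0, 1);
    from exponent 2 on, powers are purely periodic with period N. *)
Lemma corbas_expr_eqP (i j : nat) : (0 < i)%N -> (0 < j)%N ->
  (forall x : corbas phi, x ^+ i = x ^+ j) <->
  i = j \/ [/\ (1 < i)%N, (1 < j)%N & i = j %[mod N]].
Proof.
move=> i0 j0; split=> [|[->|[i1 j1 e] x] //]; last exact: corbas_expr_mod.
wlog le_ij : i j i0 j0 / (i <= j)%N => [W e|e].
  case/orP: (leq_total i j) => l; first exact: W.
  by have [//|->|[]] := W j i j0 i0 l; [left|right].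
have [->|ne_ij] := eqVneq i j; first by left.
have lt_ij : (i < j)%N by rewrite ltn_neqAle ne_ij.
have i1 : (1 < i)%N.
  rewrite ltn_neqAle i0 andbT; apply/eqP => i1.
  (* (0, 1) differs from all its higher powers, which vanish *)
  have := e (0, 1); rewrite -i1 expr1 corbas_expr_nonunit ?i1 //.
  by case=> /eqP; rewrite oner_eq0.
right; split=> //; first exact: ltn_trans lt_ij.
apply/esym/eqP; rewrite eqn_mod_dvd //; apply: corbas_period_dvd => x.
by exists i; rewrite subnKC.
Qed.

Let p_gt1 : (1 < p)%N. Proof. exact/prime_gt1/pcharf_prime/charFp. Qed.

Let q_gt1 : (0 < #|F|.-1)%N.
Proof. by rewrite -subn1 subn_gt0 finNzRing_gt1. Qed.

Let N_gt0 : (0 < N)%N. Proof. by rewrite muln_gt0 q_gt1 ltnW. Qed.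

Lemma corbas_mu1 : mu1 (corbas phi) = N.
Proof.
rewrite /mu1; case: ex_minnP => n /andP[n0 /asboolP per] min.
apply/eqP; rewrite eqn_leq; apply/andP; split.
  apply: min; rewrite /exp_period_pred N_gt0; apply/asboolP => x.
  by exists 2%N => //; apply: corbas_period.
apply: dvdn_leq => //; apply: corbas_period_dvd => x.
by have [m _ e] := per x; exists m.
Qed.

Lemma corbas_mu0 : mu0 (corbas phi) = 2%N.
Proof.
apply/eqP; rewrite eqn_leq; apply/andP; split.
  apply/bigmax_leqP => x _; case: ex_minnP => m _; apply.
  by rewrite corbas_mu1 corbas_period /=.
have := @leq_bigmax _ (fun x : corbas phi => ex_minn (exp_onset_ex x)) (0, 1).
apply: leq_trans.
case: ex_minnP => -[|[|m]] // /andP[_].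
rewrite corbas_mu1 corbas_expr_nonunit ?add1n ?ltnS // expr1 => /eqP[] /eqP.
by rewrite eq_sym oner_eq0.
Qed.

(** The exponents 1, ..., N + 1 represent each power map once: 1 is alone in its
    class, and 2, ..., N + 1 run through the residues modulo N. *)
Lemma card_power_map :
  [set f : corbas phi -> corbas phi | power_map f] #= `I_N.+1.
Proof.
pose g n (x : corbas phi) := x ^+ n.+1.
suff -> : [set f : corbas phi -> corbas phi | power_map f] = g @` `I_N.+1.
  apply: inj_card_eq => i j /set_mem /= iN /set_mem /= jN e.
  have /corbas_expr_eqP[//|//|[]//|[i1 j1]] :
    forall x : corbas phi, x ^+ i.+1 = x ^+ j.+1
      by move=> x; have := congr1 (@^~ x) e.
  case: i j i1 j1 iN jN {e} => [|i] [|j] // _ _; rewrite !ltnS => iN jN /eqP.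
  by rewrite -[i.+2]addn2 -[j.+2]addn2 eqn_modDr !modn_small // => /eqP ->.
apply/seteqP; split=> f /=; last first.
  by case=> n _ <-; exists n.+1.
case=> -[|[|n]] // _ fE; first by exists 0%N => //; apply/funext => x; rewrite fE.
exists (n %% N).+1; first by rewrite /= ltnS ltn_pmod.
apply/funext => x; rewrite fE /g; apply: corbas_expr_mod => //.
by apply/eqP; rewrite -[in X in X == _]addn2 -[n.+2]addn2 eqn_modDr modn_mod.
Qed.

Section Identity.
Hypothesis phi_id : phi =1 id.

(** A period h satisfies h ^ n = 0, which kills its first coordinate, and the
    second coordinate of (1, d) ^ n is n d. *)
Lemma periodic_power_map (n : nat) : (0 < n)%N ->
  periodic_map (fun x : corbas phi => x ^+ n) <-> (p %| n)%N.
Proof.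
move=> n0; split=> [[[c d] h0 per]|pn].
  have := per 0; rewrite add0r expr0n gtn_eqF // corbas_expr => -[/eqP].
  rewrite expf_eq0 n0 /= => /eqP c0 _; move: h0 per; rewrite {}c0 => h0 per.
  have := per (1, 0).
  have -> : ((1, 0) : corbas phi) + (0, d) = (1, d).
    by congr pair => /=; rewrite ?addr0 ?add0r.
  rewrite !corbas_expr_fixed ?phi_id // !expr1n mul0r => -[/eqP].
  rewrite mulf_eq0 -(dvdn_pcharf charFp) => /orP[/eqP d0|//].
  by rewrite d0 eqxx in h0.
exists (0, 1).
  by apply/eqP => -[] /eqP; rewrite oner_eq0.
have n0F : (n%:R = 0 :> F) by apply/eqP; rewrite -(dvdn_pcharf charFp).
have expE (x : corbas phi) : x ^+ n = (x.1 ^+ n, 0).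
  by case: x => a b; rewrite corbas_expr_fixed ?phi_id // -mulr_natr n0F !mulr0.
by move=> x; rewrite !expE /= addr0.
Qed.

(** Multiples of p are at least 2, so x ^ (p i) and x ^ (p j) agree exactly when
    p i and p j are congruent modulo N = p (q - 1), that is, when i and j are
    congruent modulo q - 1. *)
Lemma card_periodic_power_map :
  [set f : corbas phi -> corbas phi | power_map f /\ periodic_map f]
    #= `I_(#|F|.-1).
Proof.
pose g n (x : corbas phi) := x ^+ (p * n.+1).
have gt1 n : (1 < p * n.+1)%N by rewrite mulnS ltn_addr.
suff -> : [set f : corbas phi -> corbas phi | power_map f /\ periodic_map f]
    = g @` `I_(#|F|.-1).
  apply: inj_card_eq => i j /set_mem /= iN /set_mem /= jN e.
  have : p * i.+1 = p * j.+1 %[mod N].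
    have /corbas_expr_eqP[||-> //|[]//] :
      forall x : corbas phi, x ^+ (p * i.+1) = x ^+ (p * j.+1)
        by move=> x; have := congr1 (@^~ x) e.
    - exact: ltnW.
    - exact: ltnW.
  rewrite /N -!muln_modr => /eqP; rewrite eqn_pmul2l ?(ltnW p_gt1) //.
  by rewrite -[i.+1]addn1 -[j.+1]addn1 eqn_modDr !modn_small // => /eqP.
apply/seteqP; split=> f /=; last first.
  case=> n _ <-; split; first by exists (p * n.+1)%N => //; apply: ltnW.
  by apply/periodic_power_map; [exact: ltnW|exact: dvdn_mulr].
case=> -[n n0 fE]; have {fE}-> : f = fun x => x ^+ n by apply/funext.
move=> /(periodic_power_map _ n0) /dvdnP[[|m]]; first by move=> e; rewrite e in n0.
rewrite mulnC => ->; exists (m %% #|F|.-1)%N; first by rewrite /= ltn_pmod.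
apply/funext => x; apply: corbas_expr_mod => //; rewrite /N -!muln_modr.
by congr (p * _)%N; apply/eqP; rewrite -addn1 -[m.+1]addn1 eqn_modDr modn_mod.
Qed.

End Identity.
End Period.

Theorem mainTheorem6 (p k : nat) (F : finFieldType) (phi : {rmorphism F -> F}) :
  prime p -> (0 < k)%N -> #|F| = (p ^ k)%N -> bijective phi ->
  [/\ mu0 (corbas phi) = 2%N,
      mu1 (corbas phi) = (p * (p ^ k - 1))%N,
      [set f : corbas phi -> corbas phi | power_map f]
        #= `I_(p ^ k.+1 - p + 1) &
      (phi =1 id ->
       [set f : corbas phi -> corbas phi | power_map f /\ periodic_map f]
         #= `I_(p ^ k - 1))].
Proof.
move=> p_pr _ cardF _.
have charFp : p \in [pchar F] := card_finPcharP cardF p_pr.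
have -> : (p ^ k.+1 - p + 1 = (p * (p ^ k - 1)).+1)%N.
  by rewrite addn1 mulnBr muln1 expnS.
rewrite subn1 -cardF; split.
- exact: (corbas_mu0 p).
- exact: corbas_mu1.
- exact: card_power_map.
- by move=> phi_id; apply: (card_periodic_power_map p).
Qed.
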